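(* Assume GP-Hedge (the version defined in the context, with rewards given by the posterior mean $\mu_{t-1}$) is used to maximize $f$ over $A\subseteq\mathbb{R}^d$ with a collection of $N$ acquisition strategies, one of which is GP-UCB with parameters $\beta_t$. Let $\mathbf{x}_t$ be the point selected by the algorithm at iteration $t$, and let $\mathbf{x}_t^{\mathrm{UCB}}$ be the $t$-th point proposed by GP-UCB (which need not be the selected one). If we also have a bound $\gamma_T$ on the information gained at the points selected by the algorithm after $T$ iterations, i.e. $I(y_{1:T};f_{1:T})\le\gamma_T$, then with probability at least $1-\delta$ the cumulative regret $R_T=\sum_{t=1}^T\big(f(\mathbf{x}^* )-f(\mathbf{x}_t)\big)$, where $\mathbf{x}^*$ is a maximizer of $f$ over $A$, is bounded by $$R_T\;\le\;\sqrt{T\,C_1\,\beta_T\,\gamma_T}\;+\;\Big[\sum_{t=1}^T\sqrt{\beta_t}\,\sigma_{t-1}(\mathbf{x}_t^{\mathrm{UCB}})\Big]\;+\;\mathcal{O}(\sqrt{T}),$$ where $C_1=2/\log(1+\sigma^{-2})$ and $\sigma^2$ is the observation noise variance.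
   Context: Model: $f\sim\mathrm{GP}(0,k)$ on $A\subseteq\mathbb{R}^d$, with a kernel satisfying $k(\mathbf{x},\mathbf{x})\le1$ (for example the squared exponential kernel). Querying $\mathbf{x}_t$ returns $y_t=f(\mathbf{x}_t)+\epsilon_t$, with $\epsilon_t$ i.i.d. $\mathcal N(0,\sigma^2)$; to have rewards bounded in some range $[a,b]$, the noise can be assumed truncated above some large absolute value. The data are $\mathcal D_{1:t}=\{(\mathbf{x}_s,y_s)\}_{s=1}^t$, and $f_{1:T}=(f(\mathbf{x}_1),\dots,f(\mathbf{x}_T))$. Posterior: with $\mathbf{K}_t=[k(\mathbf{x}_i,\mathbf{x}_j)]_{i,j\le t}$ and $\mathbf{k}_t(\mathbf{x})=[k(\mathbf{x},\mathbf{x}_1),\dots,k(\mathbf{x},\mathbf{x}_t)]^T$, $$\mu_t(\mathbf{x})=\mathbf{k}_t(\mathbf{x})^T[\mathbf{K}_t+\sigma^2\mathbf{I}]^{-1}y_{1:t},\qquad \sigma_t^2(\mathbf{x})=k(\mathbf{x},\mathbf{x})-\mathbf{k}_t(\mathbf{x})^T[\mathbf{K}_t+\sigma^2\mathbf{I}]^{-1}\mathbf{k}_t(\mathbf{x}),$$ with $\mu_0=0$ and $\sigma_0^2(\mathbf{x})=k(\mathbf{x},\mathbf{x})$. Acquisition strategies: at iteration $t$, strategy $i\in\{1,\dots,N\}$ nominates $\mathbf{x}_t^i=\arg\max_{\mathbf{x}\in A}u_i(\mathbf{x}\mid\mathcal D_{1:t-1})$. GP-UCB with parameters $\beta_t$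 uses the acquisition function $\mu_{t-1}(\mathbf{x})+\sqrt{\beta_t}\,\sigma_{t-1}(\mathbf{x})$; its nominee is $\mathbf{x}_t^{\mathrm{UCB}}$. The nondecreasing parameters $\beta_t$ are the usual GP-UCB confidence parameters, chosen so that with high probability $|f(\mathbf{x})-\mu_{t-1}(\mathbf{x})|\le\sqrt{\beta_t}\,\sigma_{t-1}(\mathbf{x})$ for all $\mathbf{x}\in A$, $t\ge1$. For finite $A$ this holds with probability at least $1-\delta_2$ for $\beta_t=2\log(|A|\pi_t/\delta_2)$, where $\pi_t>0$, $\sum_t\pi_t^{-1}=1$, and here $\delta_2=\delta/2$; for compact $A$ the known analogous choice of $\beta_t$ from the GP-UCB analysis is used. GP-Hedge: start with gains $g_0^i=0$. At each iteration $t=1,2,\dots$: (1) compute all nominees $\mathbf{x}_t^i$; (2) choose $j$ with probability $p_t(j)=\exp(\eta g_{t-1}^j)/\sum_{\ell=1}^N\exp(\eta g_{t-1}^\ell)$ and set $\mathbf{x}_t=\mathbf{x}_t^j$; (3) observe $y_t$ and augment the data; (4) give every strategy $i$ the reward $r_t^i=\mu_{t-1}(\mathbf{x}_t^i)$ and update $g_t^i=g_{t-1}^i+r_t^i$. The parameter $\eta>0$ is suitably chosen, for example $\eta=\sqrt{8\ln N/T}$, or the time-varying $\eta_t=\sqrt{8\ln N/t}$ if $T$ is not known in advance. Information gain: $I(y_{1:T};f_{1:T})=\tfrac12\sum_{t=1}^T\log\big(1+\sigma^{-2}\sigma_{t-1}^2(\mathbf{x}_t)\big)$. *)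

(* Defs.v *)
From HB Require Import structures.
From mathcomp Require Import all_boot all_order all_algebra.
From mathcomp Require Import all_classical all_reals all_analysis.

Set Implicit Arguments.
Unset Strict Implicit.
Unset Printing Implicit Defensive.

Import Order.TTheory GRing.Theory Num.Theory.
Import numFieldNormedType.Exports.

Local Open Scope classical_set_scope.
Local Open Scope ring_scope.

(* Iterations are numbered from 1.  A point of R^n is an [n.-tuple R], which
   carries the Borel (product) sigma-algebra. *)

Definition gram (R : realType) (X : Type) (k : X -> X -> R) (D : seq (X * R)) :
    'M[R]_(size D) :=
  \matrix_(i, j) k (tnth (in_tuple D) i).1 (tnth (in_tuple D) j).1.

Definition cross_cov (R : realType) (X : Type) (k : X -> X -> R)
    (D : seq (X * R)) (x : X) : 'cV[R]_(size D) :=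
  \col_i k x (tnth (in_tuple D) i).1.

Definition observed (R : realType) (X : Type) (D : seq (X * R)) :
    'cV[R]_(size D) :=
  \col_i (tnth (in_tuple D) i).2.

Definition post_mean (R : realType) (X : Type) (k : X -> X -> R) (sigma : R)
    (D : seq (X * R)) (x : X) : R :=
  ((cross_cov k D x)^T *m invmx (gram k D + (sigma ^+ 2)%:M) *m observed D)
    ord0 ord0.

Definition post_var (R : realType) (X : Type) (k : X -> X -> R) (sigma : R)
    (D : seq (X * R)) (x : X) : R :=
  k x x -
  ((cross_cov k D x)^T *m invmx (gram k D + (sigma ^+ 2)%:M)
     *m cross_cov k D x) ord0 ord0.

Definition post_sd (R : realType) (X : Type) (k : X -> X -> R) (sigma : R)
    (D : seq (X * R)) (x : X) : R :=
  Num.sqrt (post_var k sigma D x).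

(* The acquisition function only sees the data D_{1:t-1}, so the iteration
   number is recovered as t = size D + 1. *)
Definition ucb_acquisition (R : realType) (X : Type) (k : X -> X -> R)
    (sigma : R) (beta : nat -> R) (D : seq (X * R)) (x : X) : R :=
  post_mean k sigma D x + Num.sqrt (beta (size D).+1) * post_sd k sigma D x.

Definition cov_kernel (R : realType) (X : Type) (A : set X) (k : X -> X -> R) :
    Prop :=
  (forall x y, A x -> A y -> k x y = k y x) /\
  (forall m (x : 'I_m -> X) (c : 'I_m -> R), (forall i, A (x i)) ->
     0 <= \sum_(i < m) \sum_(j < m) c i * c j * k (x i) (x j)).

(* The law N(0, v); [normal_prob] does not represent the degenerate case. *)
Definition centered_normal (R : realType) (v : R) (B : set R) : \bar R :=
  if v == 0 then \d_(0 : R) B else normal_prob 0 (Num.sqrt v) B.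

(* GP(0, k) on A: the finite-dimensional laws are centered multivariate normal
   with covariance k, i.e. every linear combination of values of f has the
   corresponding (possibly degenerate) normal law. *)
Definition gaussian_process (R : realType) (d : measure_display)
    (Omega : measurableType d) (P : probability Omega R) (X : Type)
    (A : set X) (k : X -> X -> R) (f : Omega -> X -> R) : Prop :=
  forall m (x : 'I_m -> X) (c : 'I_m -> R), (forall i, A (x i)) ->
  forall B : set R, measurable B ->
    P ((fun w => \sum_(i < m) c i * f w (x i)) @^-1` B) =
    centered_normal (\sum_(i < m) \sum_(j < m) c i * c j * k (x i) (x j)) B.

Record hedge_run (R : realType) (Omega X : Type) (N : nat) := HedgeRun {
  objective : Omega -> X -> R;
  noise : nat -> Omega -> R;
  nominee : 'I_N -> nat -> Omega -> X;
  arm : nat -> Omega -> 'I_N }.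

Definition point (R : realType) (Omega X : Type) (N : nat)
    (H : hedge_run R Omega X N) (t : nat) (w : Omega) : X :=
  nominee H (arm H t w) t w.

Definition observation (R : realType) (Omega X : Type) (N : nat)
    (H : hedge_run R Omega X N) (t : nat) (w : Omega) : R :=
  objective H w (point H t w) + noise H t w.

Definition data (R : realType) (Omega X : Type) (N : nat)
    (H : hedge_run R Omega X N) (t : nat) (w : Omega) : seq (X * R) :=
  [seq (point H s w, observation H s w) | s <- iota 1 t].

Definition reward (R : realType) (Omega X : Type) (N : nat) (k : X -> X -> R)
    (sigma : R) (H : hedge_run R Omega X N) (i : 'I_N) (t : nat) (w : Omega) :
    R :=
  post_mean k sigma (data H t.-1 w) (nominee H i t w).

Definition gain (R : realType) (Omega X : Type) (N : nat) (k : X -> X -> R)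
    (sigma : R) (H : hedge_run R Omega X N) (i : 'I_N) (t : nat) (w : Omega) :
    R :=
  \sum_(1 <= s < t.+1) reward k sigma H i s w.

Definition hedge_prob (R : realType) (Omega X : Type) (N : nat)
    (k : X -> X -> R) (sigma : R) (eta : nat -> R) (H : hedge_run R Omega X N)
    (i : 'I_N) (t : nat) (w : Omega) : R :=
  expR (eta t * gain k sigma H i t.-1 w) /
  \sum_(l < N) expR (eta t * gain k sigma H l t.-1 w).

(* A suitable learning rate for the horizon T: nonincreasing, of exact order
   1/sqrt T at time T and of order 1/sqrt t before.  With
   c0 = c1 = sqrt (8 ln N) this contains both the constant rate
   sqrt (8 ln N / T) and the time-varying rate sqrt (8 ln N / t). *)
Definition hedge_rate (R : realType) (c0 c1 : R) (T : nat) (eta : nat -> R) :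
    Prop :=
  [/\ forall s t, (0 < s)%N -> (s <= t <= T)%N -> eta t <= eta s,
      c0 / Num.sqrt T%:R <= eta T &
      forall t, (0 < t <= T)%N -> eta t <= c1 / Num.sqrt t%:R].

Definition measurable_wrt (Omega : Type) (G : set (set Omega))
    (d : measure_display) (Y : measurableType d) (g : Omega -> Y) : Prop :=
  forall B : set Y, measurable B -> G (g @^-1` B).

(* F t gathers the events determined by f and the first t iterations.
   [arm_law]: given the past, strategy i is chosen with probability p_t(i).
   [noise_law]: given the past and the choice at iteration t, the noise is
   N(0, sigma^2) truncated to [-c, c], written without the normalizing
   division; c = +oo is the untruncated normal law. *)
Record gp_hedge (R : realType) (d : measure_display) (Omega : measurableType d)
    (P : probability Omega R) (n N : nat) (A : set (n.-tuple R))
    (k : n.-tuple R -> n.-tuple R -> R) (sigma : R) (c : \bar R)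
    (u : 'I_N -> seq (n.-tuple R * R) -> n.-tuple R -> R) (eta : nat -> R)
    (F : nat -> set (set Omega)) (H : hedge_run R Omega (n.-tuple R) N) :
    Prop := GPHedge {
  filtration_sigma : forall t, sigma_algebra setT (F t);
  filtration_measurable : forall t, F t `<=` measurable;
  filtration_mono : forall s t, (s <= t)%N -> F s `<=` F t;
  objective_measurable : forall x, A x ->
    measurable_wrt (F 0%N) (fun w => objective H w x);
  nominee_measurable : forall i t, (0 < t)%N ->
    measurable_wrt (F t.-1) (nominee H i t);
  arm_measurable : forall i t, (0 < t)%N -> F t [set w | arm H t w = i];
  noise_measurable : forall t, (0 < t)%N -> measurable_wrt (F t) (noise H t);
  observation_measurable : forall t, (0 < t)%N ->
    measurable_wrt (F t) (observation H t);
  objective_law : gaussian_process P A k (objective H);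
  nominee_argmax : forall i t w, (0 < t)%N ->
    A (nominee H i t w) /\
    forall x, A x ->
      u i (data H t.-1 w) x <= u i (data H t.-1 w) (nominee H i t w);
  arm_law : forall i t E, (0 < t)%N -> F t.-1 E ->
    P (E `&` [set w | arm H t w = i]) =
    (\int[P]_(w in E) (hedge_prob k sigma eta H i t w)%:E)%E;
  noise_law : forall i t E (B : set R), (0 < t)%N -> F t.-1 E ->
    measurable B ->
    (P (E `&` [set w | arm H t w = i] `&` noise H t @^-1` B) *
       normal_prob 0 sigma [set z | (`|z|%:E <= c)%E] =
     P (E `&` [set w | arm H t w = i]) *
       normal_prob 0 sigma (B `&` [set z | (`|z|%:E <= c)%E]))%E }.

(* The set S need not be measurable (it may involve a supremum over an
   uncountable A), so the probability is bounded from inside. *)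
Definition with_prob_ge (R : realType) (d : measure_display)
    (Omega : measurableType d) (P : probability Omega R) (p : R)
    (S : set Omega) : Prop :=
  exists E, [/\ measurable E, E `<=` S & (p%:E <= P E)%E].

Definition confident (R : realType) (Omega X : Type) (N : nat) (A : set X)
    (k : X -> X -> R) (sigma : R) (beta : nat -> R)
    (H : hedge_run R Omega X N) : set Omega :=
  [set w | forall t x, (0 < t)%N -> A x ->
     `|objective H w x - post_mean k sigma (data H t.-1 w) x|
       <= Num.sqrt (beta t) * post_sd k sigma (data H t.-1 w) x].

(* Posterior means of a Gaussian model are almost surely bounded only in
   degenerate cases (f itself is Gaussian, even when the noise is truncated), so
   boundedness of the rewards is an event whose probability is to be
   controlled. *)
Definition rewards_within (R : realType) (Omega X : Type) (N : nat)
    (k : X -> X -> R) (sigma a b : R) (H : hedge_run R Omega X N) : set Omega :=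
  [set w | forall i t, (0 < t)%N -> a <= reward k sigma H i t w <= b].

Definition info_gain (R : realType) (Omega X : Type) (N : nat)
    (k : X -> X -> R) (sigma : R) (H : hedge_run R Omega X N) (T : nat)
    (w : Omega) : R :=
  2^-1 * \sum_(1 <= t < T.+1)
    ln (1 + sigma ^- 2 * post_var k sigma (data H t.-1 w) (point H t w)).

Definition cumulative_regret (R : realType) (Omega X : Type) (N : nat)
    (H : hedge_run R Omega X N) (xstar : Omega -> X) (T : nat) (w : Omega) :
    R :=
  \sum_(1 <= t < T.+1) (objective H w (xstar w) - objective H w (point H t w)).

(* Main.v *)
Require Import Defs.
From HB Require Import structures.
From mathcomp Require Import all_boot all_order all_algebra.
From mathcomp Require Import all_classical all_reals all_analysis.
From mathcomp Require Import measurable_realfun ring lra.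

Import Order.TTheory GRing.Theory Num.Theory.
Import numFieldNormedType.Exports.

Local Open Scope classical_set_scope.
Local Open Scope ring_scope.

(* On the event where the confidence bounds hold, f(x* ) is at most the UCB
   value at x_t^UCB and f(x_t) is at least the lower confidence bound at x_t, so
   the instantaneous regret is at most
     r_t^UCB - r_t + sqrt(beta_t) (sigma_{t-1}(x_t^UCB) + sigma_{t-1}(x_t)).
   The sds at the selected points are controlled by Cauchy-Schwarz and
   s ln(1 + q) <= ln(1 + q s) for 0 <= s <= 1.  The reward difference splits into
   the regret of Hedge against its own mixed reward, bounded pathwise by a
   potential argument, and a martingale.  The increments of the latter are made
   bounded by clipping the rewards, which changes nothing on the event where
   rewards lie in [a, b]; its second moment is then O(T), and since the constant
   may depend on delta, Chebyshev's inequality suffices where one would expect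
   Azuma-Hoeffding.  The failure probabilities delta/2 (confidence), rho
   (rewards) and delta/2 - rho (martingale) add up to delta. *)

Set Implicit Arguments.
Unset Strict Implicit.

(** * Elementary inequalities *)

(** Convexity of the exponential: the tangent at [s * u], evaluated at [0] and at [u], is averaged
    with weights [1 - s] and [s]. *)
Lemma expR_chord (R : realType) (s u : R) :
  0 <= s <= 1 -> expR (s * u) <= 1 - s + s * expR u.
Proof.
move=> /andP[s0 s1].
have tangent (v x : R) : expR v * (1 + (x - v)) <= expR x.
  rewrite -[leRHS](_ : expR v * expR (x - v) = _).
    by rewrite ler_wpM2l ?expR_ge0 ?expR_ge1Dx.
  by rewrite -expRD addrC subrK.
have := tangent (s * u) 0; have := tangent (s * u) u; rewrite expR0.
move: (expR _) (expR _) => e1 e2 h1 h2.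
have := ler_wpM2l s0 h1.
have s1' : 0 <= 1 - s by rewrite subr_ge0.
have := ler_wpM2l s1' h2.
lra.
Qed.

(** Multiplying [1 - x <= expR (- x)] by [expR x] gives [expR x <= 1 + x * expR x]. The last factor
    is bounded once more, by the same inequality if [0 <= x] and by [1 + x <= expR x] otherwise. *)
Lemma expR_quad (R : realType) (x m : R) :
  `|x| <= m -> expR x <= 1 + x + x ^+ 2 * expR m.
Proof.
move=> xm.
have m0 : 0 <= m by exact: le_trans xm.
have h1 : expR x - 1 <= x * expR x.
  have := ler_wpM2l (expR_ge0 x) (expR_ge1Dx (- x)).
  by rewrite -expRD subrr expR0; nra.
have h2 := expR_ge1Dx x.
have em : 1 <= expR m by rewrite -expR0 ler_expR.
have [x0|x0] := leP 0 x.
  have : expR x <= expR m by rewrite ler_expR (le_trans _ xm) ?ler_norm.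
  move: (expR x) (expR m) h1 h2 em => e f h1 h2 em ef.
  have := ler_wpM2l x0 h1.
  have := ler_wpM2l (sqr_ge0 x) ef.
  nra.
move: (expR x) (expR m) h1 h2 em => e f h1 h2 em.
have := sqr_ge0 x.
nra.
Qed.

(** Concavity of the logarithm; once exponentiated, it is [expR_chord] at [ln (1 + q)]. *)
Lemma ln_chord (R : realType) (q s : R) : 0 <= q -> 0 <= s <= 1 ->
  s * ln (1 + q) <= ln (1 + q * s).
Proof.
move=> q0 /[dup] s01 /andP[s0 s1].
have q1 : 0 < 1 + q by lra.
have qs1 : 0 < 1 + q * s by rewrite ltr_pwDl// mulr_ge0.
rewrite -ler_expR [leRHS]lnK ?posrE//.
by apply: le_trans (expR_chord _ s01) _; rewrite lnK ?posrE//; nra.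
Qed.

(** Cauchy-Schwarz against a constant vector, read off from the nonnegative sum of squared
    deviations from the mean [m]. *)
Lemma sqr_sum_le (R : realType) (x : nat -> R) (T : nat) :
  (\sum_(1 <= t < T.+1) x t) ^+ 2 <= T%:R * \sum_(1 <= t < T.+1) x t ^+ 2.
Proof.
case: T => [|T]; first by rewrite !big_geq// expr0n mul0r.
set S := \sum_(1 <= t < T.+2) x t; set Q := \sum_(1 <= t < T.+2) x t ^+ 2.
have T0 : 0 < T.+1%:R :> R by rewrite ltr0n.
set m := S / T.+1%:R.
have : 0 <= \sum_(1 <= t < T.+2) (x t - m) ^+ 2.
  by apply: sumr_ge0 => t _; exact: sqr_ge0.
have -> : \sum_(1 <= t < T.+2) (x t - m) ^+ 2 =
    Q - 2 * m * S + T.+1%:R * m ^+ 2.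
  under eq_bigr do rewrite sqrrB.
  rewrite big_split sumrB/= sumr_const_nat subn1/= -[m ^+ 2 *+ _]mulr_natl; congr (_ - _ + _).
  rewrite mulr_sumr; apply: eq_bigr => t _; rewrite -mulr_natr; ring.
have Sm : S = m * T.+1%:R by rewrite /m divfK ?gt_eqF.
move=> h; have := ler_wpM2l (ltW T0) h; rewrite mulr0 => {}h.
have -> : S ^+ 2 = 2 * T.+1%:R * m * S - T.+1%:R ^+ 2 * m ^+ 2.
  by rewrite Sm; ring.
lra.
Qed.

(** Telescoping, since the inverse of [Num.sqrt T.+1%:R] is at most twice the increment of the
    square root from [T] to [T.+1]. *)
Lemma sum_inv_sqrt (R : realType) (T : nat) :
  \sum_(1 <= t < T.+1) (Num.sqrt t%:R)^-1 <= 2 * Num.sqrt T%:R :> R.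
Proof.
elim: T => [|T IH]; first by rewrite big_geq// sqrtr0 mulr0.
rewrite big_nat_recr//=.
have p0 : 0 < Num.sqrt T.+1%:R :> R by rewrite sqrtr_gt0 ltr0n.
have h : Num.sqrt T%:R <= Num.sqrt T.+1%:R :> R by rewrite ler_sqrt ?ler0n// ler_nat.
have e1 : Num.sqrt T.+1%:R ^+ 2 = Num.sqrt T%:R ^+ 2 + 1 :> R.
  by rewrite !sqr_sqrtr ?ler0n// natr1.
have : (Num.sqrt T.+1%:R)^-1 <= 2 * Num.sqrt T.+1%:R - 2 * Num.sqrt T%:R :> R.
  rewrite -(ler_pM2l p0) divff ?gt_eqF//.
  by move: (sqrtr_ge0 (T%:R : R)); nra.
by move: IH; lra.
Qed.

(** * Regret of Hedge against its mixed reward *)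

(* The normalised potential [(1/e) ln (mean exp (e G))] is nondecreasing in
   [e], which is what makes a nonincreasing learning rate harmless. *)
Definition potential (R : realType) (N : nat) (e : R) (G : 'I_N -> R) : R :=
  ln (N%:R^-1 * \sum_i expR (e * G i)) / e.

Lemma mean_expR_gt0 (R : realType) (N : nat) (e : R) (G : 'I_N -> R) :
  (0 < N)%N -> 0 < N%:R^-1 * \sum_i expR (e * G i).
Proof.
case: N G => // N G _; rewrite mulr_gt0 ?invr_gt0 ?ltr0n// big_ord_recl.
by rewrite ltr_pwDl ?expR_gt0// sumr_ge0// => i _; exact: expR_ge0.
Qed.

(** Monotonicity of power means: shifting [G] by [m] normalises the mean of [expR (e * (G i - m))]
    to 1, and raising the terms to the power [e' / e], which is at least 1, cannot bring the mean
    below 1. *)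
Lemma potential_mono (R : realType) (N : nat) (e e' : R) (G : 'I_N -> R) :
  (0 < N)%N -> 0 < e -> e <= e' -> potential e G <= potential e' G.
Proof.
move=> N0 e0 ee'; have e'0 : 0 < e' by exact: lt_le_trans ee'.
have N0' : 0 < N%:R :> R by rewrite ltr0n.
set m := potential e G.
rewrite /potential ler_pdivlMr// -ler_expR lnK ?posrE ?mean_expR_gt0//.
have mean1 : N%:R^-1 * \sum_i expR (e * (G i - m)) = 1.
  under eq_bigr do rewrite mulrBr expRB.
  rewrite -mulr_suml mulrA /m /potential mulrCA divff ?gt_eqF// mulr1.
  by rewrite lnK ?posrE ?mean_expR_gt0// divff// gt_eqF// mean_expR_gt0.
suff : 1 <= N%:R^-1 * \sum_i expR (e' * (G i - m)).
  under eq_bigr do rewrite mulrBr expRB.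
  by rewrite -mulr_suml mulrA ler_pdivlMr ?expR_gt0// mul1r [m * _]mulrC.
have s01 : 0 <= e / e' <= 1.
  by rewrite ler_pdivrMr// mul1r ee' andbT divr_ge0// ltW.
(* Bernoulli's inequality for the exponent [e' / e], obtained from [expR_chord] with [s = e / e'];
   its left-hand sides average to 1. *)
have bern i : 1 + e' / e * (expR (e * (G i - m)) - 1) <= expR (e' * (G i - m)).
  have := expR_chord (e' * (G i - m)) s01.
  rewrite mulrA divfK ?gt_eqF//.
  have -> : e' / e = (e / e')^-1 by rewrite invf_div.
  move: s01; have : 0 < e / e' by rewrite divr_gt0.
  move: (e / e') (expR _) (expR _) => s x y s0 s01 h.
  rewrite -(ler_pM2l s0) mulrDr mulrA divff ?gt_eqF//; lra.
have : N%:R^-1 * \sum_(i < N) (1 + e' / e * (expR (e * (G i - m)) - 1)) = 1.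
  rewrite big_split/= -mulr_sumr sumrB/= !sumr_const card_ord.
  rewrite mulrDr mulVf ?gt_eqF// mulrCA [X in _ + _ * X]mulrBr mean1.
  by rewrite mulVf ?gt_eqF// subrr mulr0 addr0.
by move=> h; rewrite -[leLHS]h ler_wpM2l ?invr_ge0 ?ler0n//; apply: ler_sum => i _.
Qed.

(** Deterministic form of [hedge_prob], which unfolds to it; the regret bound can thus be proved for
    arbitrary reward sequences. *)
Definition hedge_weight (R : realType) (N : nat) (e : R) (G : 'I_N -> R)
  (i : 'I_N) : R := expR (e * G i) / \sum_l expR (e * G l).

Lemma sum_expR_gt0 (R : realType) (N : nat) (e : R) (G : 'I_N -> R) :
  (0 < N)%N -> 0 < \sum_i expR (e * G i).
Proof.
by move=> N0; have := mean_expR_gt0 e G N0; rewrite pmulr_rgt0// invr_gt0 ltr0n.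
Qed.

Lemma hedge_weight_ge0 (R : realType) (N : nat) (e : R) (G : 'I_N -> R)
  (i : 'I_N) : 0 <= hedge_weight e G i.
Proof. by rewrite divr_ge0 ?expR_ge0// sumr_ge0// => l _; exact: expR_ge0. Qed.

Lemma sum_hedge_weight (R : realType) (N : nat) (e : R) (G : 'I_N -> R) :
  (0 < N)%N -> \sum_i hedge_weight e G i = 1.
Proof. by move=> N0; rewrite -mulr_suml divff// gt_eqF// sum_expR_gt0. Qed.

(** The ratio of the two exponential sums is the weighted mean of [expR (e * r i)]; [expR_quad] and
    [ln (1 + x) <= x] finish. The cap [e1] on the rates makes the error factor [expR (e1 * M)] the
    same in all rounds. Hoeffding's lemma would be sharper, but only in the constant. *)
Lemma potential_step (R : realType) (N : nat) (e e1 M : R) (G r : 'I_N -> R) :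
  (0 < N)%N -> 0 < e <= e1 -> (forall i, `|r i| <= M) ->
  potential e (fun i => G i + r i) - potential e G <=
  \sum_i hedge_weight e G i * r i + e * (M ^+ 2 * expR (e1 * M)).
Proof.
move=> N0 /andP[e0 ee1] rM.
have N0' : 0 < N%:R :> R by rewrite ltr0n.
have M0 : 0 <= M by exact: le_trans (rM (Ordinal N0)).
rewrite /potential -mulrBl ler_pdivrMr// -ln_div ?posrE ?mean_expR_gt0//.
have -> : (N%:R^-1 * \sum_i expR (e * (G i + r i))) /
    (N%:R^-1 * \sum_i expR (e * G i)) =
    \sum_i hedge_weight e G i * expR (e * r i).
  rewrite -mulf_div divff ?invr_eq0 ?gt_eqF// mul1r mulr_suml.
  apply: eq_bigr => i _; rewrite mulrDr expRD /hedge_weight; ring.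
have step : \sum_i hedge_weight e G i * expR (e * r i) <=
    1 + (e * \sum_i hedge_weight e G i * r i +
         e ^+ 2 * M ^+ 2 * expR (e1 * M)).
  have -> : 1 + (e * \sum_i hedge_weight e G i * r i +
         e ^+ 2 * M ^+ 2 * expR (e1 * M)) =
     \sum_i hedge_weight e G i *
       (1 + e * r i + e ^+ 2 * M ^+ 2 * expR (e1 * M)).
    under [RHS]eq_bigr do rewrite !mulrDr mulr1.
    rewrite !big_split/= -[X in _ = _ + X]mulr_suml sum_hedge_weight// mul1r addrA.
    by congr (_ + _ + _); rewrite mulr_sumr; apply: eq_bigr => i _; ring.
  apply: ler_sum => i _; rewrite ler_wpM2l ?hedge_weight_ge0//.
  apply: le_trans (expR_quad (m := e1 * M) _) _.
    by rewrite normrM ger0_norm ?ler_pM// ltW.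
  rewrite lerD2l ler_wpM2r ?expR_ge0// exprMn ler_wpM2l ?sqr_ge0//.
  by rewrite -real_normK ?num_real// lerXn2r ?nnegrE.
have pos : 0 < \sum_i hedge_weight e G i * expR (e * r i).
  under eq_bigr do rewrite mulrAC -expRD -mulrDr.
  by rewrite -mulr_suml divr_gt0 ?sum_expR_gt0.
have lnB1 : ln (\sum_i hedge_weight e G i * expR (e * r i)) <=
    \sum_i hedge_weight e G i * expR (e * r i) - 1.
  by rewrite -ler_expR lnK ?posrE//; apply: le_trans (expR_ge1Dx _); lra.
lra.
Qed.

(** The potential starts at 0, grows each round by at most the mixed reward plus a multiple of
    [eta t], and ends above the gain of [j] minus [ln N%:R / eta T]. The rate conditions make both
    error terms of order [Num.sqrt T%:R]. *)
Lemma hedge_regret (R : realType) (N T : nat) (c0 c1 M : R) (eta : nat -> R)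
    (r : 'I_N -> nat -> R) (j : 'I_N) :
  (0 < T)%N -> 0 < c0 -> hedge_rate c0 c1 T eta ->
  (forall i t, (0 < t <= T)%N -> `|r i t| <= M) ->
  \sum_(1 <= t < T.+1) r j t -
  \sum_(1 <= t < T.+1) \sum_i
     hedge_weight (eta t) (fun l => \sum_(1 <= s < t.-1.+1) r l s) i * r i t <=
  (ln N%:R / c0 + 2 * c1 * (M ^+ 2 * expR (c1 * M))) * Num.sqrt T%:R.
Proof.
move=> T0 c00 [eta_mono eta_lb eta_ub] rM.
have N0 : (0 < N)%N by case: (N) j => // -[].
have sT0 : 0 < Num.sqrt T%:R :> R by rewrite sqrtr_gt0 ltr0n.
have etaT0 : 0 < eta T by apply: lt_le_trans eta_lb; rewrite divr_gt0.
have eta0 t : (0 < t <= T)%N -> 0 < eta t.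
  by move=> /andP[t0 tT]; apply: lt_le_trans etaT0 _; rewrite eta_mono// tT leqnn.
have c10 : 0 < c1.
  have := lt_le_trans (eta0 1%N _) (eta_ub 1%N _).
  by rewrite sqrtr1 divr1 T0; exact.
have eta_c1 t : (0 < t <= T)%N -> eta t <= c1.
  move=> tT; apply: le_trans (eta_ub _ tT) _.
  case/andP: tT => t0 _; rewrite ler_pdivrMr ?sqrtr_gt0 ?ltr0n//.
  by rewrite ler_peMr ?(ltW c10)// -[leLHS]sqrtr1 ler_sqrt ?ler0n// ler1n.
set K := M ^+ 2 * expR (c1 * M).
have K0 : 0 <= K by rewrite mulr_ge0 ?sqr_ge0 ?expR_ge0.
pose G t (l : 'I_N) := \sum_(1 <= s < t.+1) r l s.
pose mix t := \sum_i hedge_weight (eta t) (G t.-1) i * r i t.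
have GS t : G t.+1 = fun l => G t l + r l t.+1.
  by apply: funext => l; rewrite /G big_nat_recr.
have G0 e : potential e (G 0%N) = 0.
  rewrite /potential; under eq_bigr do rewrite /G big_geq// mulr0 expR0.
  by rewrite sumr_const card_ord mulVf ?ln1 ?mul0r// pnatr_eq0 -lt0n.
have main m : (m < T)%N ->
    potential (eta m.+1) (G m.+1) <= \sum_(1 <= t < m.+2) (mix t + eta t * K).
  elim: m => [|m IH] mT.
    rewrite big_nat1 -[leLHS]subr0 -(G0 (eta 1%N)) GS.
    apply: potential_step => //.
    - by rewrite eta0//= eta_c1.
    - by move=> i; apply: rM.
  rewrite big_nat_recr//=.
  have step : potential (eta m.+2) (G m.+2) - potential (eta m.+2) (G m.+1) <=
      mix m.+2 + eta m.+2 * K.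
    rewrite GS; apply: potential_step => //.
    - by rewrite eta0//= eta_c1.
    - by move=> i; apply: rM.
  (* Passing to the smaller rate of the next round can only lower the potential, so the rounds still
     telescope. *)
  have mono : potential (eta m.+2) (G m.+1) <= potential (eta m.+1) (G m.+1).
    by apply: potential_mono; rewrite ?eta0// eta_mono// leqnSn.
  by have := IH (ltnW mT); lra.
(* Only the term of [j] is kept in the sum of exponentials; the normalisation [N%:R^-1] costs
   [ln N%:R / eta T]. *)
have low : G T j - ln N%:R / eta T <= potential (eta T) (G T).
  rewrite /potential lnM ?posrE ?invr_gt0 ?ltr0n ?sum_expR_gt0//.
  rewrite lnV ?posrE ?ltr0n// mulrDl mulNr [leLHS]addrC lerD2l ler_pdivlMr// mulrC.
  rewrite -ler_expR lnK ?posrE ?sum_expR_gt0// (bigD1 j)//= lerDl.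
  by apply: sumr_ge0 => i _; exact: expR_ge0.
have := main T.-1; rewrite prednK// leqnn => /(_ isT) up.
have sumeta : \sum_(1 <= t < T.+1) eta t * K <= 2 * c1 * K * Num.sqrt T%:R.
  rewrite -mulr_suml mulrAC ler_wpM2r//.
  apply: (@le_trans _ _ (\sum_(1 <= t < T.+1) c1 * (Num.sqrt t%:R)^-1)).
    by apply: ler_sum_nat => t tT; exact: eta_ub.
  by rewrite -mulr_sumr [leRHS]mulrAC [leRHS]mulrC ler_wpM2l ?(ltW c10)// sum_inv_sqrt.
have lnN : ln N%:R / eta T <= ln N%:R / c0 * Num.sqrt T%:R.
  rewrite -mulrA ler_wpM2l ?ln_ge0 ?ler1n// -[leRHS]invrK lef_pV2 ?posrE//.
    by rewrite invfM invrK.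
  by rewrite invr_gt0 mulr_gt0// invr_gt0.
rewrite big_split/= in up.
rewrite mulrDl; move: low up sumeta lnN; rewrite -/(G T j) -/mix /mix; lra.
Qed.

(** * Gaussian posterior *)

Section posterior.
Context (R : realType) (X : Type) (A : set X) (k : X -> X -> R) (sigma : R).
Hypotheses (hk : cov_kernel A k) (sigma_gt0 : 0 < sigma).
Variable D : seq (X * R).
Hypothesis hD : forall i, A (tnth (in_tuple D) i).1.

Let pt (i : 'I_(size D)) := (tnth (in_tuple D) i).1.
Let M := gram k D + (sigma ^+ 2)%:M.

Let sqnormE m (v : 'cV[R]_m) : (v^T *m v) ord0 ord0 = \sum_i v i ord0 ^+ 2.
Proof. by rewrite mxE; apply: eq_bigr => i _; rewrite mxE expr2. Qed.

Let gram_quadE (v : 'cV[R]_(size D)) :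
  (v^T *m gram k D *m v) ord0 ord0 =
  \sum_i \sum_j v i ord0 * v j ord0 * k (pt i) (pt j).
Proof.
rewrite mxE exchange_big/=; apply: eq_bigr => j _; rewrite mxE mulr_suml.
by apply: eq_bigr => i _; rewrite !mxE; ring.
Qed.

Let reg_quadE (v : 'cV[R]_(size D)) :
  (v^T *m M *m v) ord0 ord0 =
  (v^T *m gram k D *m v) ord0 ord0 + sigma ^+ 2 * \sum_i v i ord0 ^+ 2.
Proof.
by rewrite /M mulmxDr mulmxDl mxE mul_mx_scalar -scalemxAl [in X in _ + X]mxE sqnormE.
Qed.

Let gram_quad_ge0 (v : 'cV[R]_(size D)) : 0 <= (v^T *m gram k D *m v) ord0 ord0.
Proof. by rewrite gram_quadE; exact: hk.2. Qed.

Let reg_sym : M^T = M.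
Proof.
rewrite /M linearD/= tr_scalar_mx; congr (_ + _).
by apply/matrixP => i j; rewrite !mxE hk.1.
Qed.

(** On a kernel vector the quadratic form vanishes, yet it is a nonnegative Gram part plus
    [sigma ^+ 2] times the squared norm. *)
Lemma gram_reg_unit : gram k D + (sigma ^+ 2)%:M \in unitmx.
Proof.
rewrite -row_free_unit; apply: inj_row_free => v vM.
have /eqP : (v^T^T *m M *m v^T) ord0 ord0 = 0 by rewrite trmxK vM mul0mx mxE.
have sq0 : 0 <= \sum_i v^T i ord0 ^+ 2.
  by apply: sumr_ge0 => i _; exact: sqr_ge0.
have sn0 := mulr_ge0 (sqr_ge0 sigma) sq0.
rewrite reg_quadE paddr_eq0 ?gram_quad_ge0// => /andP[_].
rewrite mulf_eq0 sqrf_eq0 gt_eqF//= psumr_eq0; last by move=> i _; exact: sqr_ge0.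
move=> /allP v0; apply/rowP => i; rewrite mxE.
by have := v0 i (mem_index_enum _); rewrite sqrf_eq0 mxE => /eqP.
Qed.

(** With [v] the solution of [M *m v = cross_cov k D x], the variance is [k x x] minus the quadratic
    form of [M] at [v], which gives the upper bound. The lower bound is positivity of the kernel on
    the data enlarged by [x]. *)
Lemma post_var_itv x : A x -> 0 <= post_var k sigma D x <= k x x.
Proof.
move=> Ax; set v := invmx M *m cross_cov k D x.
have Mv : M *m v = cross_cov k D x by rewrite mulKVmx ?gram_reg_unit.
have varE : post_var k sigma D x = k x x - (v^T *m M *m v) ord0 ord0.
  rewrite /post_var -mulmxA -/M -/v -{1}Mv; congr (_ - _).
  by rewrite trmx_mul reg_sym.
have crossE : (v^T *m M *m v) ord0 ord0 = \sum_i v i ord0 * k x (pt i).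
  by rewrite -mulmxA Mv mxE; apply: eq_bigr => i _; rewrite !mxE.
have sq0 : 0 <= \sum_i v i ord0 ^+ 2 by apply: sumr_ge0 => i _; exact: sqr_ge0.
have s2 := sqr_ge0 sigma.
have sn0 := mulr_ge0 s2 sq0.
have q0 := gram_quad_ge0 v.
have rE := reg_quadE v.
rewrite varE; apply/andP; split; last by lra.
(* Coefficient 1 at [x] and [- v] at the data: the kernel form is [k x x] minus twice the form of
   [M] at [v] plus that of the Gram matrix, and the latter is at most the form of [M]. *)
pose y (i : 'I_(size D).+1) := if unlift ord0 i is Some j then pt j else x.
pose c (i : 'I_(size D).+1) := if unlift ord0 i is Some j then - v j ord0 else 1.
have Ay i : A (y i) by rewrite /y; case: unliftP => // j _; exact: hD.
have := hk.2 _ y c Ay; rewrite big_ord_recl !big_ord_recl.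
have y0 : y ord0 = x by rewrite /y unlift_none.
have c0 : c ord0 = 1 by rewrite /c unlift_none.
have yS j : y (lift ord0 j) = pt j by rewrite /y liftK.
have cS j : c (lift ord0 j) = - v j ord0 by rewrite /c liftK.
rewrite y0 c0 !mul1r.
under eq_bigr do rewrite yS cS mul1r mulNr.
under [X in _ + X]eq_bigr => i _.
  rewrite big_ord_recl y0 c0 yS cS mulr1 mulNr (hk.1 _ _ (hD i) Ax) -/(pt i).
  under eq_bigr do rewrite yS cS mulrNN.
  over.
rewrite /= big_split/= !sumrN -gram_quadE -crossE; lra.
Qed.

End posterior.

(** Cramer form: the inverse becomes an adjugate over a determinant, polynomial in the entries, and
    the dimension is a fixed [m] instead of the data-dependent [size D]. *)
Lemma post_mean_adj (R : realType) (X : Type) (A : set X) (k : X -> X -> R)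
    (sigma : R) (D : seq (X * R)) (d : X * R) (m : nat) (x : X) :
  cov_kernel A k -> 0 < sigma -> (forall i, A (tnth (in_tuple D) i).1) ->
  size D = m ->
  let K : 'M[R]_m :=
    \matrix_(i, j) k (nth d D i).1 (nth d D j).1 + (sigma ^+ 2)%:M in
  post_mean k sigma D x =
  (\det K)^-1 * ((\row_(i < m) k x (nth d D i).1) *m \adj K *m
                  (\col_(i < m) (nth d D i).2)) ord0 ord0.
Proof.
move=> hk s0 hD Dm; subst m => K.
rewrite /post_mean /invmx (gram_reg_unit hk)// -scalemxAr -scalemxAl mxE.
have -> : gram k D + (sigma ^+ 2)%:M = K.
  by congr (_ + _); apply/matrixP => i j; rewrite !mxE !(tnth_nth d).
congr (_ * (_ *m _ *m _) _ _).
  by apply/rowP => i; rewrite !mxE (tnth_nth d).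
by apply/colP => i; rewrite !mxE (tnth_nth d).
Qed.

(** * Measurability of the posterior mean *)

(** The inverse is written through a real power of the square; at 0 both sides are 0 by the
    convention that the inverse of 0 is 0. *)
Lemma measurable_invr (R : realType) :
  measurable_fun [set: R] (fun x : R => x^-1).
Proof.
rewrite (_ : (fun x : R => x^-1) = fun x => x * (x ^+ 2) `^ (-1)).
  apply: measurable_funM => //.
  have msq : measurable_fun [set: R] (fun x : R => x ^+ 2).
    exact: measurable_funX.
  exact: (measurableT_comp (@measurable_powR R (-1)) msq).
apply: funext => x; rewrite powR_inv1 ?sqr_ge0//.
have [->|x0] := eqVneq x 0; first by rewrite invr0 mul0r.
by rewrite expr2 invfM mulrA divff// mul1r.
Qed.

(** Summands outside the range are replaced by 0, so measurability is required only inside it: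
    rewards and increments are handled at positive times only. *)
Lemma measurable_sum_nat (R : realType) d (T : measurableType d) (D : set T)
    (m n : nat) (h : nat -> T -> R) :
  (forall s, (m <= s < n)%N -> measurable_fun D (h s)) ->
  measurable_fun D (fun w => \sum_(m <= s < n) h s w).
Proof.
move=> mh; pose h' s := if (m <= s < n)%N then h s else cst 0.
rewrite (_ : (fun w => _) = fun w => \sum_(m <= s < n) h' s w); last first.
  by apply: funext => w; apply: eq_big_nat => s ms; rewrite /h' ms.
by apply: measurable_sum => s; rewrite /h'; case: ifPn => // ms; exact: mh.
Qed.

Section measurable_matrix.
Context d (T : measurableType d) (R : realType).

Definition mx_measurable m n (K : T -> 'M[R]_(m, n)) : Prop :=
  forall i j, measurable_fun setT (fun w => K w i j).

Lemma measurable_det m (K : T -> 'M[R]_m) : mx_measurable K ->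
  measurable_fun setT (fun w => \det (K w)).
Proof.
move=> mK; apply: measurable_sum => s; apply: measurable_funM => //.
by apply: measurable_prod => i _; exact: mK.
Qed.

Lemma mx_measurable_adj m (K : T -> 'M[R]_m) : mx_measurable K ->
  mx_measurable (fun w => \adj (K w)).
Proof.
move=> mK i j; under eq_fun do rewrite mxE.
apply: measurable_funM => //; apply: measurable_det => i' j'.
by under eq_fun do rewrite !mxE; exact: mK.
Qed.

Lemma mx_measurable_mul m n p (K : T -> 'M[R]_(m, n)) (L : T -> 'M[R]_(n, p)) :
  mx_measurable K -> mx_measurable L -> mx_measurable (fun w => K w *m L w).
Proof.
move=> mK mL i j; under eq_fun do rewrite mxE.
by apply: measurable_sum => l; apply: measurable_funM; [exact: mK|exact: mL].
Qed.

End measurable_matrix.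

Lemma tnth_data_in (R : realType) (X : Type) (A : set X) (p : nat -> X)
    (y : nat -> R) (m : nat) :
  (forall s, (0 < s <= m)%N -> A (p s)) ->
  forall i, A (tnth (in_tuple [seq (p s, y s) | s <- iota 1 m]) i).1.
Proof.
move=> Ap i; rewrite (tnth_nth (p 0%N, y 0%N))/=.
case: i => i /=; rewrite size_map size_iota => im.
by rewrite (nth_map 0%N) ?size_iota// nth_iota//; exact: Ap.
Qed.

(** In Cramer form only sums, products and one inverse of kernel values and observations occur. The
    source [T] is arbitrary so that it can be [Omega] equipped with the sigma-algebra of the
    past. *)
Lemma measurable_post_mean (R : realType) d (T : measurableType d)
    d' (X : measurableType d') (A : set X) (k : X -> X -> R) (sigma : R)
    (p : nat -> T -> X) (y : nat -> T -> R) (x : T -> X) (m : nat) :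
  cov_kernel A k -> 0 < sigma ->
  measurable_fun setT (fun q : X * X => k q.1 q.2) ->
  (forall s w, (0 < s <= m)%N -> A (p s w)) ->
  (forall s, (0 < s <= m)%N -> measurable_fun setT (p s)) ->
  (forall s, (0 < s <= m)%N -> measurable_fun setT (y s)) ->
  measurable_fun setT x ->
  measurable_fun setT
    (fun w => post_mean k sigma [seq (p s w, y s w) | s <- iota 1 m] (x w)).
Proof.
move=> hk s0 mk Ap mp my mx.
have km (f g : T -> X) : measurable_fun setT f -> measurable_fun setT g ->
    measurable_fun setT (fun w => k (f w) (g w)).
  by move=> mf mg; exact: (measurableT_comp mk (measurable_fun_pair mf mg)).
have iS (i : 'I_m) : (0 < i.+1 <= m)%N by rewrite ltn_ord.
have AD w : forall i, A (tnth (in_tuple [seq (p s w, y s w) | s <- iota 1 m]) i).1.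
  by apply: tnth_data_in => s; exact: Ap.
have sD w : size [seq (p s w, y s w) | s <- iota 1 m] = m.
  by rewrite size_map size_iota.
have nD w (i : 'I_m) : nth (p 0%N w, y 0%N w) [seq (p s w, y s w) | s <- iota 1 m] i
    = (p i.+1 w, y i.+1 w).
  by rewrite (nth_map 0%N) ?size_iota// nth_iota.
pose K w : 'M[R]_m :=
  \matrix_(i, j) k (p i.+1 w) (p j.+1 w) + (sigma ^+ 2)%:M.
rewrite (_ : (fun w => _) = fun w => (\det (K w))^-1 *
   ((\row_(i < m) k (x w) (p i.+1 w)) *m \adj (K w) *m
    (\col_(i < m) y i.+1 w)) ord0 ord0); last first.
  apply: funext => w; rewrite (post_mean_adj (p 0%N w, y 0%N w) (x w) hk s0 (AD w) (sD w)).
  have -> : \matrix_(i, j) k (nth (p 0%N w, y 0%N w) [seq (p s w, y s w) | s <- iota 1 m] i).1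
     (nth (p 0%N w, y 0%N w) [seq (p s w, y s w) | s <- iota 1 m] j).1 +
     (sigma ^+ 2)%:M = K w.
    by congr (_ + _); apply/matrixP => i j; rewrite !mxE !nD.
  congr (_ * (_ *m _ *m _) _ _).
    by apply/rowP => i; rewrite !mxE nD.
  by apply/colP => i; rewrite !mxE nD.
have mK : mx_measurable K.
  move=> i j; under eq_fun do rewrite !mxE.
  by apply: measurable_funD => //; apply: km; apply: mp.
apply: measurable_funM.
  exact: (measurableT_comp (@measurable_invr R) (measurable_det mK)).
apply: mx_measurable_mul => [|i j]; last first.
  by under eq_fun do rewrite mxE; apply: my.
apply: mx_measurable_mul => [i j|]; last exact: mx_measurable_adj.
by under eq_fun do rewrite mxE; apply: km => //; apply: mp.
Qed.

(** Turns measurability with respect to a stage of the filtration into ordinary measurability on a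
    retyped [Omega], where the closure lemmas apply. *)
Lemma measurable_wrtP (Omega : pointedType) (G : set (set Omega))
    d (Y : measurableType d) (g : Omega -> Y) :
  sigma_algebra setT G ->
  measurable_wrt G g <-> measurable_fun setT (g : g_sigma_algebraType G -> Y).
Proof.
move=> sG; split => [mg _ B mB|mg B mB].
  by rewrite setTI; apply: sub_sigma_algebra; exact: mg.
rewrite -(measurable_g_measurableTypeE sG) -[_ @^-1` _]setTI; exact: mg.
Qed.

(** * Second moments of bounded martingales *)

Section bounded_functions.
Context (R : realType) d (T : measurableType d) (P : probability T R).

Lemma bounded_integrable (f : T -> R) (K : R) :
  measurable_fun setT f -> (forall w, `|f w| <= K) ->
  P.-integrable setT (EFin \o f).
Proof.
move=> mf fK; apply: measurable_bounded_integrable => //.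
  exact: le_lt_trans (probability_le1 P measurableT) (ltry _).
exists K; split; first exact: num_real.
by move=> y Ky w _; apply: le_trans (fK w) (ltW Ky).
Qed.

Lemma normr_Rintegral_le (f : T -> R) (K : R) :
  measurable_fun setT f -> (forall w, `|f w| <= K) ->
  `|\int[P]_w f w| <= K.
Proof.
move=> mf fK; have If := bounded_integrable mf fK.
apply: le_trans (le_normr_Rintegral _ If) _ => //.
rewrite (_ : K = \int[P]_w (cst K w)); last first.
  by rewrite Rintegral_cst// [X in fine X](_ : _ = 1%E) ?mulr1//; exact: (probability_setT P).
apply: le_Rintegral => //.
- apply: (@bounded_integrable _ K) => [|w]; last by rewrite normr_id.
  exact: measurableT_comp.
- exact: (@bounded_integrable _ `|K|).
Qed.

Lemma Rintegral_indic (E : set T) : measurable E ->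
  \int[P]_w \1_E w = fine (P E).
Proof. by move=> mE; rewrite /Rintegral integral_indic// setIT. Qed.

Lemma Rintegral_sum_eq0 I (s : seq I) (f : I -> T -> R) (K : R) :
  (forall i, measurable_fun setT (f i)) -> (forall i w, `|f i w| <= K) ->
  (forall i, \int[P]_w f i w = 0) -> \int[P]_w (\sum_(i <- s) f i w) = 0.
Proof.
move=> mf fK f0; elim: s => [|i s IH].
  under eq_Rintegral do rewrite big_nil.
  by rewrite Rintegral_cst// mul0r.
under eq_Rintegral do rewrite big_cons.
rewrite RintegralD//.
- by rewrite f0 IH addr0.
- exact: bounded_integrable.
- apply: (@bounded_integrable _ (\sum_(j <- s) K)).
    exact: measurable_sum.
  by move=> w; apply: le_trans (ler_norm_sum _ _ _) _; exact: ler_sum.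
Qed.

(** Pythagoras: the cross term of the square integrates to 0. *)
Lemma second_moment_step (S X : T -> R) (L b : R) :
  measurable_fun setT S -> measurable_fun setT X ->
  (forall w, `|S w| <= L) -> (forall w, `|X w| <= b) ->
  \int[P]_w (S w * X w) = 0 ->
  \int[P]_w ((S w + X w) ^+ 2) <= \int[P]_w (S w ^+ 2) + b ^+ 2.
Proof.
move=> mS mX SL Xb SX0.
have b0 : 0 <= b by exact: le_trans (Xb point).
have L0 : 0 <= L by exact: le_trans (SL point).
have sq (f : T -> R) K : measurable_fun setT f -> (forall w, `|f w| <= K) ->
    measurable_fun setT (fun w => f w ^+ 2) /\
    forall w : T, `|f w ^+ 2| <= K ^+ 2.
  move=> mf fK; split=> [|w]; first exact: measurable_funX.
  by rewrite normrX lerXn2r ?nnegrE// (le_trans _ (fK w)).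
have [mS2 S2] := sq _ _ mS SL; have [mX2 X2] := sq _ _ mX Xb.
have mSX : measurable_fun setT (fun w => S w * X w) by exact: measurable_funM.
have SX w : `|S w * X w| <= L * b by rewrite normrM ler_pM.
have mSX2 : measurable_fun setT (fun w => 2 * (S w * X w)).
  exact: measurable_funM.
have SX2 w : `|2 * (S w * X w)| <= 2 * (L * b).
  by rewrite normrM ger0_norm// ler_wpM2l.
under eq_Rintegral do rewrite sqrrD -mulr_natl.
rewrite RintegralD//; last 2 first.
- apply: (@bounded_integrable _ (L ^+ 2 + 2 * (L * b))).
    exact: measurable_funD.
  by move=> w; apply: le_trans (ler_normD _ _) _; exact: lerD.
- exact: bounded_integrable X2.
rewrite RintegralD//; last 2 first.
- exact: bounded_integrable S2.
- exact: bounded_integrable SX2.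
rewrite RintegralZl//; last exact: bounded_integrable SX.
rewrite SX0 mulr0 addr0 lerD2l (le_trans (ler_norm _))//.
exact: normr_Rintegral_le.
Qed.

(** Chebyshev's inequality, by integrating the pointwise bound of [a ^+ 2] times the indicator of
    the tail event by [S w ^+ 2]. *)
Lemma second_moment_tail (S : T -> R) (L a : R) :
  measurable_fun setT S -> (forall w, `|S w| <= L) -> 0 < a ->
  a ^+ 2 * fine (P [set w | a <= `|S w|]) <= \int[P]_w (S w ^+ 2).
Proof.
move=> mS SL a0.
have mE : measurable [set w | a <= `|S w|].
  rewrite (_ : [set w | _] = (fun w => a <= `|S w|) @^-1` [set true]).
    rewrite -[_ @^-1` _]setTI; apply: measurable_fun_ler => //.
    exact: measurableT_comp.
  by apply/seteqP; split.
rewrite -Rintegral_indic// -RintegralZl//; last first.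
  apply: (@bounded_integrable _ 1) => [|w]; first exact: measurable_indic.
  by rewrite indicE; case: (_ \in _); rewrite ?normr1 ?normr0.
apply: le_Rintegral => //.
- apply: (@bounded_integrable _ (a ^+ 2)).
    by apply: measurable_funM => //; exact: measurable_indic.
  move=> w; rewrite normrM ger0_norm ?sqr_ge0// indicE.
  by case: (_ \in _); rewrite ?normr1 ?normr0 ?mulr1 ?mulr0 ?sqr_ge0.
- apply: (@bounded_integrable _ (L ^+ 2)); first exact: measurable_funX.
  by move=> w; rewrite normrX lerXn2r ?nnegrE// (le_trans _ (SL w)).
move=> w _; rewrite indicE; case: (boolP (w \in _)) => [|_]; last first.
  by rewrite mulr0 sqr_ge0.
rewrite inE/= => aS; rewrite mulr1 -[leRHS]real_normK ?num_real//.
by rewrite lerXn2r ?nnegrE// ltW.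
Qed.

End bounded_functions.

(** * Orthogonality to bounded functions of the past *)

Section orthogonality.
Context (R : realType) d (T : measurableType d) (P : probability T R).
Variables (G : set (set T)) (Z : T -> R) (K : R).
Hypotheses (sG : sigma_algebra setT G) (Gm : G `<=` measurable).
Hypotheses (mZ : measurable_fun setT Z) (ZK : forall w, `|Z w| <= K).
Hypothesis Z0 : forall E, G E -> \int[P]_w (\1_E w * Z w) = 0.

Lemma measurable_wrt_fun (Y : T -> R) :
  measurable_wrt G Y -> measurable_fun setT Y.
Proof. by move=> mY _ B mB; rewrite setTI; apply: Gm; exact: mY. Qed.

(* Bisection: subtracting [L / 2] on the event [L / 2 <= Y] does not change
   the integral against [Z] and halves the range of [Y]. *)
Lemma halve_range (Y : T -> R) (L : R) :
  measurable_wrt G Y -> (forall w, 0 <= Y w <= L) ->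
  exists Y' : T -> R, [/\ measurable_wrt G Y', forall w, 0 <= Y' w <= L / 2 &
    \int[P]_w (Y w * Z w) = \int[P]_w (Y' w * Z w)].
Proof.
move=> mY YL.
have mYG : measurable_fun setT (Y : g_sigma_algebraType G -> R).
  exact/measurable_wrtP.
pose E := [set w | L / 2 <= Y w].
have GE : G E.
  rewrite (_ : E = Y @^-1` `[L / 2, +oo[); first exact: mY.
  by apply/seteqP; split => w /=; rewrite in_itv/= andbT.
have mE : measurable E by exact: Gm.
pose Y' w := Y w - L / 2 * \1_E w.
have mY' : measurable_wrt G Y'.
  apply/measurable_wrtP => //; apply: measurable_funB => //.
  apply: measurable_funM => //; apply: measurable_indic.
  by rewrite measurable_g_measurableTypeE.
have Y'L w : 0 <= Y' w <= L / 2.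
  rewrite /Y' indicE; have := YL w.
  case: (boolP (w \in E)); first by rewrite inE /E/= mulr1 => ? /andP[? ?]; lra.
  rewrite notin_setE /E/= mulr0 subr0 => /negP; rewrite -ltNge => ? /andP[-> _]/=.
  exact: ltW.
exists Y'; split => //.
have L0 : 0 <= L by have /andP[y0] := YL point; exact: le_trans.
have K0 : 0 <= K by exact: le_trans (ZK point).
have mEZ : measurable_fun setT (fun w => \1_E w * Z w).
  by apply: measurable_funM => //; exact: measurable_indic.
have EZ w : `|\1_E w * Z w| <= K.
  rewrite indicE; case: (_ \in _); rewrite ?mul1r ?mul0r ?normr0//.
have IEZ := bounded_integrable P mEZ EZ.
have -> : \int[P]_w (Y w * Z w) =
    \int[P]_w (Y' w * Z w + L / 2 * (\1_E w * Z w)).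
  by apply: eq_Rintegral => w _; rewrite /Y'; ring.
rewrite RintegralD//.
- by rewrite RintegralZl// Z0// mulr0 addr0.
- apply: (@bounded_integrable _ _ _ _ _ (L / 2 * K)).
    by apply: measurable_funM => //; exact: measurable_wrt_fun.
  move=> w; rewrite normrM ler_pM//; have /andP[y0 yL] := Y'L w.
  by rewrite ger0_norm.
- apply: (@bounded_integrable _ _ _ _ _ (L / 2 * K)).
    exact: measurable_funM.
  by move=> w; rewrite normrM ger0_norm ?ler_wpM2l// divr_ge0.
Qed.

(** After [n] bisections the multiplier lies between 0 and [L / 2 ^+ n] while the integral is
    unchanged, so the integral is smaller than any positive number. *)
Lemma orthogonal_ge0 (Y : T -> R) (L : R) :
  measurable_wrt G Y -> (forall w, 0 <= Y w <= L) ->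
  \int[P]_w (Y w * Z w) = 0.
Proof.
move=> mY YL; have K0 : 0 <= K by exact: le_trans (ZK point).
have small n : `|\int[P]_w (Y w * Z w)| <= L * K * (2 ^+ n)^-1.
  suff [Y' [mY' Y'L ->]] : exists Y' : T -> R, [/\ measurable_wrt G Y',
      forall w, 0 <= Y' w <= L * (2 ^+ n)^-1 &
      \int[P]_w (Y w * Z w) = \int[P]_w (Y' w * Z w)].
    apply: normr_Rintegral_le => [|w].
      by apply: measurable_funM => //; exact: measurable_wrt_fun.
    rewrite normrM mulrAC ler_pM//; have /andP[y0 yL] := Y'L w.
    by rewrite ger0_norm.
  elim: n => [|n [Y1 [m1 L1 ->]]]; first by exists Y; rewrite expr0 invr1 mulr1.
  have [Y2 [m2 L2 ->]] := halve_range m1 L1.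
  by exists Y2; rewrite exprS invfM [2^-1 * _]mulrC mulrA.
apply/eqP; rewrite -normr_le0 leNgt; apply/negP => I0.
(* This [n] exceeds [L * K / I], hence so does [2 ^+ n], contradicting [small]. *)
set I := `|_| in small I0; have := small (Num.truncn (L * K / I)).+1.
rewrite leNgt => /negP; apply; rewrite ltr_pdivrMr ?exprn_gt0// [ltRHS]mulrC -ltr_pdivrMr//.
apply: lt_le_trans (truncnS_gt _) _.
by rewrite -[2 ^+ _]natrX ler_nat ltnW// ltn_expl.
Qed.

(** Adding [L] makes the multiplier nonnegative, and the constant [L] is itself a nonnegative
    multiplier. *)
Lemma orthogonal_bounded (Y : T -> R) (L : R) :
  measurable_wrt G Y -> (forall w, `|Y w| <= L) -> \int[P]_w (Y w * Z w) = 0.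
Proof.
move=> mY YL; have L0 : 0 <= L by exact: le_trans (YL point).
have cst0 : \int[P]_w (L * Z w) = 0.
  apply: (@orthogonal_ge0 (cst L) L) => [|w]; last by rewrite L0 lexx.
  exact/measurable_wrtP.
have : \int[P]_w ((Y w + L) * Z w) = 0.
  apply: (@orthogonal_ge0 (fun w => Y w + L) (L + L)) => [|w].
    by apply/measurable_wrtP => //; apply: measurable_funD => //; exact/measurable_wrtP.
  by have := YL w; rewrite ler_norml => /andP[? ?]; lra.
under eq_Rintegral do rewrite mulrDl.
rewrite RintegralD// ?cst0 ?addr0//.
- apply: (@bounded_integrable _ _ _ _ _ (L * K)).
    by apply: measurable_funM => //; exact: measurable_wrt_fun.
  by move=> w; rewrite normrM ler_pM.
- apply: (@bounded_integrable _ _ _ _ _ (L * K)).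
    exact: measurable_funM.
  by move=> w; rewrite normrM ger0_norm// ler_wpM2l.
Qed.

End orthogonality.

(** * GP-Hedge *)

Section regret_decomposition.
Context (R : realType) (Omega X : Type) (N : nat) (A : set X).
Variables (k : X -> X -> R) (sigma : R) (beta : nat -> R) (T : nat) (gamma : R).
Variables (H : hedge_run R Omega X N) (ucb : 'I_N) (xstar : Omega -> X).
Variables (w : Omega) (u : 'I_N -> seq (X * R) -> X -> R).
Hypotheses (hk : cov_kernel A k) (hkdiag : forall x, A x -> k x x <= 1).
Hypotheses (sigma_gt0 : 0 < sigma) (T_gt0 : (0 < T)%N).
Hypothesis beta_ge0 : forall t, (0 < t)%N -> 0 <= beta t.
Hypothesis beta_mono :
  forall s t, (0 < s)%N -> (s <= t)%N -> beta s <= beta t.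
Hypothesis u_ucb : u ucb = ucb_acquisition k sigma beta.
Hypothesis nominee_max : forall i t, (0 < t)%N ->
  A (nominee H i t w) /\
  forall x, A x -> u i (data H t.-1 w) x <= u i (data H t.-1 w) (nominee H i t w).
Hypothesis w_confident : confident A k sigma beta H w.
Hypothesis xstar_in : A (xstar w).
Hypothesis gain_le : info_gain k sigma H T w <= gamma.

Let sd t := post_sd k sigma (data H t.-1 w) (Defs.point H t w).
Let var t := post_var k sigma (data H t.-1 w) (Defs.point H t w).

Lemma size_data m : size (data H m w) = m.
Proof. by rewrite size_map size_iota. Qed.

Lemma point_in t : (0 < t)%N -> A (Defs.point H t w).
Proof. by move=> t0; have [] := nominee_max (arm H t w) t0. Qed.

Lemma data_var_itv t : (0 < t)%N -> 0 <= var t <= 1.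
Proof.
move=> t0; have /andP[v0 v1] : 0 <= var t <= k (Defs.point H t w) (Defs.point H t w).
  apply: (post_var_itv hk) => //; last exact: point_in.
  by apply: tnth_data_in => s /andP[s0 _]; exact: point_in.
by rewrite v0 (le_trans v1)// hkdiag//; exact: point_in.
Qed.

(** Variances lie between 0 and 1, so [ln_chord] with [q = sigma ^- 2] bounds their sum by
    [2 / L * gamma], the 2 undoing the factor one half in [info_gain]. Monotonicity of [beta] and
    Cauchy-Schwarz do the rest. *)
Lemma sum_sd_le :
  \sum_(1 <= t < T.+1) Num.sqrt (beta t) * sd t <=
  Num.sqrt (T%:R * (2 / ln (1 + sigma ^- 2)) * beta T * gamma).
Proof.
set L := ln (1 + sigma ^- 2).
have q0 : 0 < sigma ^- 2 by rewrite invr_gt0 exprn_gt0.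
have L0 : 0 < L by rewrite ln_gt0// ltrDl.
have var_le : \sum_(1 <= t < T.+1) var t <= 2 / L * gamma.
  rewrite mulrAC ler_pdivlMr// mulr_suml.
  apply: (@le_trans _ _ (2 * info_gain k sigma H T w)); last by rewrite ler_wpM2l.
  rewrite /info_gain mulrA divff ?mul1r//.
  apply: ler_sum_nat => t /andP[t0 _].
  by apply: ln_chord; [exact: ltW|exact: data_var_itv].
have bT : 0 <= beta T by exact: beta_ge0.
have TR : 0 <= T%:R :> R by exact: ler0n.
apply: (@le_trans _ _ (Num.sqrt (beta T) * \sum_(1 <= t < T.+1) sd t)).
  rewrite mulr_sumr.
  apply: ler_sum_nat => t /andP[t0 tT].
  by rewrite ler_wpM2r ?sqrtr_ge0// ler_sqrt// beta_mono.
rewrite -(mulrA _ (beta T)) mulrCA sqrtrM// ler_wpM2l ?sqrtr_ge0//.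
have sd0 : 0 <= \sum_(1 <= t < T.+1) sd t.
  by apply: sumr_ge0 => t _; exact: sqrtr_ge0.
rewrite -[leLHS]ger0_norm// -sqrtr_sqr ler_wsqrtr//.
apply: le_trans (sqr_sum_le _ _) _.
rewrite -mulrA ler_wpM2l//; apply: le_trans var_le.
apply: ler_sum_nat => t /andP[t0 tT].
by rewrite sqr_sqrtr//; have /andP[] := data_var_itv t0.
Qed.

Lemma regret_decomposition :
  cumulative_regret H xstar T w <=
  Num.sqrt (T%:R * (2 / ln (1 + sigma ^- 2)) * beta T * gamma) +
  \sum_(1 <= t < T.+1)
     Num.sqrt (beta t) * post_sd k sigma (data H t.-1 w) (nominee H ucb t w) +
  (\sum_(1 <= t < T.+1) reward k sigma H ucb t w -
   \sum_(1 <= t < T.+1) reward k sigma H (arm H t w) t w).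
Proof.
apply: le_trans (lerD (lerD sum_sd_le (lexx _)) (lexx _)).
rewrite -sumrB -!big_split/= /cumulative_regret.
apply: ler_sum_nat => t /andP[t0 tT].
have := w_confident t0 xstar_in; have := w_confident t0 (point_in t0).
rewrite !ler_norml => /andP[low _] /andP[_ up].
have [_ /(_ _ xstar_in)] := nominee_max ucb t0.
(* The data before round [t] have length [t.-1], so the acquisition function reads exactly
   [beta t]. *)
rewrite u_ucb /ucb_acquisition size_data prednK// => umax.
move: low up umax; rewrite /sd /reward -/(Defs.point H t w); lra.
Qed.

End regret_decomposition.

(** * The martingale of the random arm choices *)

Section hedge_martingale.
Context (R : realType) d (Omega : measurableType d) (P : probability Omega R).
Variables (n N : nat) (A : set (n.-tuple R)) (k : n.-tuple R -> n.-tuple R -> R).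
Variables (sigma : R) (c : \bar R).
Variables (u : 'I_N -> seq (n.-tuple R * R) -> n.-tuple R -> R) (eta : nat -> R).
Variables (F : nat -> set (set Omega)) (H : hedge_run R Omega (n.-tuple R) N).
Hypothesis hk : cov_kernel A k.
Hypothesis k_measurable :
  measurable_fun setT (fun p : n.-tuple R * n.-tuple R => k p.1 p.2).
Hypotheses (sigma_gt0 : 0 < sigma) (N_gt0 : (0 < N)%N).
Hypothesis model : gp_hedge P A k sigma c u eta F H.
Variable M : R.
Hypothesis M_ge0 : 0 <= M.

Lemma filtration_measurable_wrt d' (Y : measurableType d') s t (g : Omega -> Y) :
  (s <= t)%N -> measurable_wrt (F s) g -> measurable_wrt (F t) g.
Proof. by move=> st mg B mB; apply: (filtration_mono model st); exact: mg. Qed.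

Lemma filtration_funP d' (Y : measurableType d') t (g : Omega -> Y) :
  measurable_wrt (F t) g <->
  measurable_fun setT (g : g_sigma_algebraType (F t) -> Y).
Proof. exact: measurable_wrtP (filtration_sigma model t). Qed.

(** The preimage splits over the finitely many arms; on each piece the selected point is a
    nominee. *)
Lemma point_measurable t : (0 < t)%N -> measurable_wrt (F t) (Defs.point H t).
Proof.
move=> t0 B mB.
rewrite (_ : _ @^-1` B =
    \big[setU/set0]_(i < N) ([set w | arm H t w = i] `&` nominee H i t @^-1` B)).
  rewrite -(measurable_g_measurableTypeE (filtration_sigma model t)).
  apply: bigsetU_measurable => i _; apply: measurableI;
    rewrite (measurable_g_measurableTypeE (filtration_sigma model t)).
    exact: (arm_measurable model).
  apply: (filtration_measurable_wrt (leq_pred t)) mB.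
  exact: (nominee_measurable model).
apply/seteqP; split => w /=.
  by move=> Bw; rewrite -bigcup_seq; exists (arm H t w) => //=; exact: mem_index_enum.
by rewrite -bigcup_seq => -[i _ [<-]].
Qed.

(** Predictability: the reward reads only earlier data and a nominee fixed before the arm is
    drawn. *)
Lemma reward_measurable i t : (0 < t)%N ->
  measurable_wrt (F t.-1) (reward k sigma H i t).
Proof.
move=> t0; apply/filtration_funP.
apply: (measurable_post_mean hk) => //.
- by move=> s w /andP[s0 _]; have [] := nominee_argmax model (arm H s w) w s0.
- move=> s /andP[s0 st]; apply/filtration_funP.
  by apply: (filtration_measurable_wrt st); exact: point_measurable.
- move=> s /andP[s0 st]; apply/filtration_funP.
  by apply: (filtration_measurable_wrt st); exact: (observation_measurable model).
- by apply/filtration_funP; exact: (nominee_measurable model).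
Qed.

Lemma hedge_prob_measurable i t : (0 < t)%N ->
  measurable_wrt (F t.-1) (hedge_prob k sigma eta H i t).
Proof.
move=> t0; apply/filtration_funP.
have mexp l : measurable_fun setT
    ((fun w => expR (eta t * gain k sigma H l t.-1 w)) :
      g_sigma_algebraType (F t.-1) -> R).
  have mg : measurable_fun setT
      ((fun w => eta t * gain k sigma H l t.-1 w) :
        g_sigma_algebraType (F t.-1) -> R).
    apply: measurable_funM => //.
    apply: measurable_sum_nat => s /andP[s0 st].
    apply/filtration_funP; apply: filtration_measurable_wrt (reward_measurable l s0).
    by rewrite (leq_trans (leq_pred _)).
  exact: (measurableT_comp (@measurable_expR R) mg).
apply: measurable_funM; first exact: mexp.
exact: (measurableT_comp (@measurable_invr R) (measurable_sum _ mexp)).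
Qed.

(* Clipping makes the increments bounded everywhere, not just on the event where
   the rewards are bounded, so that they stay martingale differences. *)
Definition clipped_reward i t w : R :=
  Num.max (- M) (Num.min M (reward k sigma H i t w)).

(** Mixed minus collected clipped reward, written arm by arm so that each term is a predictable
    factor times a compensated indicator. *)
Definition hedge_increment t w : R :=
  \sum_i clipped_reward i t w *
    (hedge_prob k sigma eta H i t w - \1_[set w | arm H t w = i] w).

Definition hedge_martingale m w : R := \sum_(1 <= t < m.+1) hedge_increment t w.

Lemma normr_clipped_reward i t w : `|clipped_reward i t w| <= M.
Proof.
have MM : - M <= M by apply: le_trans M_ge0; rewrite oppr_le0.
by rewrite ler_norml le_max lexx ge_max MM ge_min lexx.
Qed.

Lemma clipped_rewardE i t w :
  `|reward k sigma H i t w| <= M -> clipped_reward i t w = reward k sigma H i t w.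
Proof.
by rewrite ler_norml /clipped_reward => /andP[lo up]; rewrite (min_idPr up) (max_idPr lo).
Qed.

Lemma sum_arm t w (r : 'I_N -> R) :
  \sum_i r i * \1_[set w | arm H t w = i] w = r (arm H t w).
Proof.
rewrite (bigD1 (arm H t w))//= indicE mem_set// mulr1 big1 ?addr0// => i /eqP iN.
by rewrite indicE memNset ?mulr0//= => /esym.
Qed.

Lemma hedge_incrementE t w :
  hedge_increment t w =
  \sum_i hedge_prob k sigma eta H i t w * clipped_reward i t w -
  clipped_reward (arm H t w) t w.
Proof.
rewrite -(sum_arm t w (fun i => clipped_reward i t w)) -sumrB.
by apply: eq_bigr => i _; ring.
Qed.

Lemma normr_hedge_increment t w : `|hedge_increment t w| <= 2 * M.
Proof.
rewrite hedge_incrementE (le_trans (ler_normB _ _))//.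
have -> : 2 * M = M + M by ring.
apply: lerD; last exact: normr_clipped_reward.
apply: le_trans (ler_norm_sum _ _ _) _.
rewrite -[leRHS]mul1r -(sum_hedge_weight (eta t) (fun l => gain k sigma H l t.-1 w) N_gt0).
rewrite mulr_suml; apply: ler_sum => i _.
have p0 : 0 <= hedge_prob k sigma eta H i t w by exact: hedge_weight_ge0.
by rewrite normrM (ger0_norm p0) ler_wpM2l// normr_clipped_reward.
Qed.

Lemma clipped_reward_measurable i t : (0 < t)%N ->
  measurable_wrt (F t.-1) (clipped_reward i t).
Proof.
move=> t0; apply/filtration_funP; apply: measurable_maxr => //.
by apply: measurable_minr => //; apply/filtration_funP; exact: reward_measurable.
Qed.

Lemma hedge_increment_measurable t : (0 < t)%N ->
  measurable_wrt (F t) (hedge_increment t).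
Proof.
move=> t0; apply/filtration_funP; apply: measurable_sum => i.
apply: measurable_funM.
  apply/filtration_funP; apply: (filtration_measurable_wrt (leq_pred t)).
  exact: clipped_reward_measurable.
apply: measurable_funB.
  apply/filtration_funP; apply: (filtration_measurable_wrt (leq_pred t)).
  exact: hedge_prob_measurable.
apply: measurable_indic.
rewrite (measurable_g_measurableTypeE (filtration_sigma model t)).
exact: (arm_measurable model).
Qed.

Lemma hedge_martingale_measurable m : measurable_wrt (F m) (hedge_martingale m).
Proof.
apply/filtration_funP; apply: measurable_sum_nat => s /andP[s0 st].
apply/filtration_funP; apply: filtration_measurable_wrt (hedge_increment_measurable s0).
by rewrite -ltnS.
Qed.

Lemma normr_hedge_martingale m w : `|hedge_martingale m w| <= m%:R * (2 * M).
Proof.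
apply: le_trans (ler_norm_sum _ _ _) _.
apply: (@le_trans _ _ (\sum_(1 <= t < m.+1) 2 * M)).
  by apply: ler_sum => t _; exact: normr_hedge_increment.
by rewrite sumr_const_nat subn1/= [leRHS]mulr_natl.
Qed.

Lemma wrt_measurable t (Y : Omega -> R) :
  measurable_wrt (F t) Y -> measurable_fun setT Y.
Proof. exact: (measurable_wrt_fun (@filtration_measurable _ _ _ _ _ _ _ _ _ _ _ _ _ _ model t)). Qed.

(** By [arm_law], the selection probability and the indicator of the arm have equal integrals over
    each event of the past. *)
Lemma arm_compensated i t E : (0 < t)%N -> F t.-1 E ->
  \int[P]_w (\1_E w * (hedge_prob k sigma eta H i t w -
                       \1_[set w | arm H t w = i] w)) = 0.
Proof.
move=> t0 FE.
have mE : measurable E by exact: (filtration_measurable model) FE.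
have ma : measurable [set w | arm H t w = i].
  exact: (filtration_measurable model) (arm_measurable model i t0).
have mp := wrt_measurable (hedge_prob_measurable i t0).
have p0 w : 0 <= hedge_prob k sigma eta H i t w by exact: hedge_weight_ge0.
have p1 w : hedge_prob k sigma eta H i t w <= 1.
  rewrite -(sum_hedge_weight (eta t) (fun l => gain k sigma H l t.-1 w) N_gt0).
  by rewrite (bigD1 i)//= lerDl sumr_ge0// => l _; exact: hedge_weight_ge0.
have b1 (U : set Omega) w : `|\1_U w : R| <= 1.
  by rewrite indicE; case: (_ \in _); rewrite ?normr1 ?normr0.
under eq_Rintegral do rewrite mulrBr.
rewrite RintegralB//; last 2 first.
- apply: (@bounded_integrable _ _ _ _ _ 1).
    by apply: measurable_funM => //; exact: measurable_indic.
  by move=> w; rewrite normrM -[leRHS]mulr1 ler_pM// ger0_norm.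
- apply: (@bounded_integrable _ _ _ _ _ 1).
    by apply: measurable_funM => //; exact: measurable_indic.
  by move=> w; rewrite normrM -[leRHS]mulr1 ler_pM.
apply/eqP; rewrite subr_eq0; apply/eqP.
rewrite [RHS](_ : _ = \int[P]_w \1_(E `&` [set w | arm H t w = i]) w); last first.
  by apply: eq_Rintegral => w _; rewrite indicI.
rewrite Rintegral_indic; last exact: measurableI.
rewrite (arm_law model i t0 FE).
rewrite [RHS](_ : _ = \int[P]_w ((hedge_prob k sigma eta H i t) \_ E) w);
  last by rewrite -Rintegral_mkcond.
apply: eq_Rintegral => w _; rewrite patchE indicE.
by case: (w \in E); rewrite ?mul1r ?mul0r.
Qed.

(** Arm by arm, the martingale times the clipped reward is bounded and [F m]-measurable, hence
    orthogonal to the compensated indicator of round [m.+1]. *)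
Lemma hedge_increment_orthogonal m :
  \int[P]_w (hedge_martingale m w * hedge_increment m.+1 w) = 0.
Proof.
under eq_Rintegral do rewrite mulr_sumr.
have mS := hedge_martingale_measurable m.
set p := fun i w => hedge_prob k sigma eta H i m.+1 w -
                    \1_[set w | arm H m.+1 w = i] w.
have mZ i : measurable_fun setT (p i).
  apply: measurable_funB.
    exact: wrt_measurable (hedge_prob_measurable i (ltn0Sn m)).
  apply: measurable_indic.
  exact: (filtration_measurable model) (arm_measurable model i (ltn0Sn m)).
have Z2 i w : `|p i w| <= 2.
  have p0 : 0 <= hedge_prob k sigma eta H i m.+1 w by exact: hedge_weight_ge0.
  have p1 : hedge_prob k sigma eta H i m.+1 w <= 1.
    rewrite -(sum_hedge_weight (eta m.+1) (fun l => gain k sigma H l m w) N_gt0).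
    by rewrite (bigD1 i)//= lerDl sumr_ge0// => l _; exact: hedge_weight_ge0.
  rewrite /p indicE ler_norml; case: (_ \in _) => /=; lra.
have mY i : measurable_wrt (F m)
    (fun w => hedge_martingale m w * clipped_reward i m.+1 w).
  apply/filtration_funP; apply: measurable_funM; apply/filtration_funP => //.
  exact: (@clipped_reward_measurable i m.+1).
have Y2 i w : `|hedge_martingale m w * clipped_reward i m.+1 w| <=
    m%:R * (2 * M) * M.
  by rewrite normrM ler_pM// ?normr_hedge_martingale ?normr_clipped_reward.
apply: (@Rintegral_sum_eq0 _ _ _ _ _ _
   (fun i w => hedge_martingale m w * (clipped_reward i m.+1 w * p i w))
   (m%:R * (2 * M) * M * 2)) => [i|i w|i].
- under eq_fun do rewrite mulrA.
  by apply: measurable_funM => //; exact: wrt_measurable (mY i).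
- by rewrite mulrA normrM ler_pM.
- under eq_Rintegral do rewrite mulrA.
  apply: (orthogonal_bounded (filtration_sigma model m) _ (mZ i) (Z2 i) _ (mY i) (Y2 i)).
    exact: (filtration_measurable model).
  by move=> E FE; exact: (@arm_compensated i m.+1).
Qed.

Lemma hedge_martingale_second_moment m :
  \int[P]_w (hedge_martingale m w ^+ 2) <= m%:R * (2 * M) ^+ 2.
Proof.
elim: m => [|m IH].
  under eq_Rintegral do rewrite /hedge_martingale big_geq// expr0n/=.
  by rewrite Rintegral_cst// !mul0r.
under eq_Rintegral do rewrite /hedge_martingale big_nat_recr//=.
have := @second_moment_step _ _ _ P (hedge_martingale m) (hedge_increment m.+1)
  _ _ (wrt_measurable (hedge_martingale_measurable m))
  (wrt_measurable (hedge_increment_measurable (ltn0Sn m)))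
  (normr_hedge_martingale m) (normr_hedge_increment m.+1)
  (hedge_increment_orthogonal m).
by move=> /le_trans; apply; rewrite -[m.+1%:R]natr1 [leRHS]mulrDl mul1r lerD2r.
Qed.

(** Chebyshev at a level whose square is the second-moment bound [m%:R * (2 * M) ^+ 2] divided by
    [r]. *)
Lemma hedge_martingale_tail m (r : R) : (0 < m)%N -> 0 < M -> 0 < r ->
  with_prob_ge P (1 - r)
    [set w | hedge_martingale m w <= 2 * M / Num.sqrt r * Num.sqrt m%:R].
Proof.
move=> m0 M0 r0; set a := 2 * M / _ * _.
have m0' : 0 < m%:R :> R by rewrite ltr0n.
have a0 : 0 < a by rewrite !mulr_gt0// ?invr_gt0 sqrtr_gt0.
have mS := wrt_measurable (hedge_martingale_measurable m).
have mB : measurable [set w | a <= `|hedge_martingale m w|].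
  rewrite (_ : [set w | _] = (fun w => a <= `|hedge_martingale m w|) @^-1` [set true]).
    rewrite -[_ @^-1` _]setTI; apply: measurable_fun_ler => //.
    exact: measurableT_comp.
  by apply/seteqP; split.
exists (~` [set w | a <= `|hedge_martingale m w|]); split.
- exact: measurableC.
- move=> w /= /negP; rewrite -ltNge => /ltW; apply: le_trans; exact: ler_norm.
rewrite probability_setC// -[X in (1 - X)%E]fineK ?fin_num_measure// lee_fin lerD2l lerN2.
have tail := second_moment_tail P mS (normr_hedge_martingale m) a0.
have := le_trans tail (hedge_martingale_second_moment m).
have -> : a ^+ 2 = m%:R * (2 * M) ^+ 2 / r.
  rewrite /a !exprMn exprVn !sqr_sqrtr ?ltW//; ring.
by rewrite mulrAC ler_pdivrMr// ler_pM2l// mulr_gt0// exprn_gt0// mulr_gt0.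
Qed.

End hedge_martingale.

(** * Combining probability bounds *)

Section with_probability.
Context (R : realType) d (Omega : measurableType d) (P : probability Omega R).

(** Union bound on the complements of the inner measurable events. *)
Lemma with_prob_geI (p q : R) (S1 S2 : set Omega) :
  with_prob_ge P (1 - p) S1 -> with_prob_ge P (1 - q) S2 ->
  with_prob_ge P (1 - (p + q)) (S1 `&` S2).
Proof.
move=> [E1 [m1 E1S p1]] [E2 [m2 E2S p2]]; exists (E1 `&` E2); split.
- exact: measurableI.
- exact: setISS.
have compl (E : set Omega) (r : R) : measurable E -> ((1 - r)%:E <= P E)%E ->
    (P (~` E) <= r%:E)%E.
  move=> mE; rewrite probability_setC//.
  rewrite -[P E]fineK ?fin_num_measure// -EFinB !lee_fin; lra.
have : (P (~` E1 `|` ~` E2) <= (p + q)%:E)%E.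
  apply: le_trans (measureU2 _ _ _) _; try exact: measurableC.
  by rewrite EFinD; apply: leeD; exact: compl.
rewrite -setCI probability_setC; last exact: measurableI.
rewrite -[P (E1 `&` E2)]fineK; last by apply: fin_num_measure; exact: measurableI.
rewrite -EFinB !lee_fin; lra.
Qed.

(** The form [1 - 0] presents an almost sure event as one of failure probability 0, ready for
    [with_prob_geI]. *)
Lemma with_prob_ge_ae (S : set Omega) :
  {ae P, forall w, S w} -> with_prob_ge P (1 - 0) S.
Proof.
move=> [B [mB PB0 SB]]; exists (~` B); split.
- exact: measurableC.
- by move=> w Bw; apply: contrapT => Sw; apply: Bw; exact: SB.
by rewrite probability_setC// PB0 sube0 subr0.
Qed.

Lemma with_prob_ge_sub (p q : R) (S1 S2 : set Omega) :
  q <= p -> S1 `<=` S2 -> with_prob_ge P p S1 -> with_prob_ge P q S2.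
Proof.
move=> qp S12 [E [mE ES pE]]; exists E; split => //; first exact: subset_trans S12.
by apply: le_trans pE; rewrite lee_fin.
Qed.

End with_probability.

Unset Implicit Arguments.
Set Strict Implicit.

(* MathComp-Analysis world.  The constant C of the O(sqrt T) term depends only
   on N, delta, the reward range [a, b], its exceptional probability rho (rho = 0
   for almost surely bounded rewards) and the constants of the learning rate. *)
Theorem theorem1 (R : realType) (N : nat) (delta a b rho c0 c1 : R)
    (hdelta : 0 < delta < 1) (hrho : 0 <= rho < delta / 2) (hc0 : 0 < c0) :
  exists C : R,
  forall (d : measure_display) (Omega : measurableType d)
    (P : probability Omega R) (n : nat) (A : set (n.-tuple R))
    (k : n.-tuple R -> n.-tuple R -> R) (sigma : R) (c : \bar R)
    (u : 'I_N -> seq (n.-tuple R * R) -> n.-tuple R -> R) (ucb : 'I_N)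
    (beta eta : nat -> R) (F : nat -> set (set Omega))
    (H : hedge_run R Omega (n.-tuple R) N) (xstar : Omega -> n.-tuple R)
    (T : nat) (gamma : R)
    (hkernel : cov_kernel A k)
    (hkmeas : measurable_fun setT (fun p : n.-tuple R * n.-tuple R => k p.1 p.2))
    (hkdiag : forall x, A x -> k x x <= 1)
    (hsigma : 0 < sigma)
    (hc : (0 < c)%E)
    (hT : (0 < T)%N)
    (heta : hedge_rate c0 c1 T eta)
    (hbeta0 : forall t, (0 < t)%N -> 0 <= beta t)
    (hbeta : forall s t, (0 < s)%N -> (s <= t)%N -> beta s <= beta t)
    (hucb : u ucb = ucb_acquisition k sigma beta)
    (hmodel : gp_hedge P A k sigma c u eta F H)
    (hconf : with_prob_ge P (1 - delta / 2) (confident A k sigma beta H))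
    (hrewards : with_prob_ge P (1 - rho) (rewards_within k sigma a b H))
    (hxstar : {ae P, forall w, A (xstar w) /\
       forall x, A x -> objective H w x <= objective H w (xstar w)})
    (hgamma : {ae P, forall w, info_gain k sigma H T w <= gamma}),
  with_prob_ge P (1 - delta)
    [set w | cumulative_regret H xstar T w <=
       Num.sqrt (T%:R * (2 / ln (1 + sigma ^- 2)) * beta T * gamma)
       + \sum_(1 <= t < T.+1)
           Num.sqrt (beta t) *
           post_sd k sigma (data H t.-1 w) (nominee H ucb t w)
       + C * Num.sqrt T%:R].
Proof.
case/andP: hdelta => delta0 delta1; case/andP: hrho => rho0 rho_lt.
(* Dominates every reward in the range; the added 1 keeps [M] positive even if [a] and [b]
   vanish. *)
pose M : R := `|a| + `|b| + 1.
have M0 : 0 < M by rewrite ltr_wpDl// addr_ge0.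
(* The failure probability left for the martingale. *)
pose r := delta / 2 - rho.
have r0 : 0 < r by rewrite subr_gt0.
(* The Hedge regret constant of [hedge_regret] plus the Chebyshev constant of
   [hedge_martingale_tail]. *)
exists (ln N%:R / c0 + 2 * c1 * (M ^+ 2 * expR (c1 * M)) + 2 * M / Num.sqrt r).
move=> d Omega P n A k sigma c u ucb beta eta F H xstar T gamma hkernel hkmeas
  hkdiag hsigma hc hT heta hbeta0 hbeta hucb hmodel hconf hrewards hxstar hgamma.
have N0 : (0 < N)%N by exact: leq_ltn_trans (leq0n _) (ltn_ord ucb).
have hmart := hedge_martingale_tail hkernel hkmeas hsigma N0 hmodel (ltW M0) hT M0 r0.
have := with_prob_geI (with_prob_geI (with_prob_geI (with_prob_geI hconf hrewards)
  (with_prob_ge_ae hxstar)) (with_prob_ge_ae hgamma)) hmart.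
apply: with_prob_ge_sub; first by rewrite /r; lra.
move=> w [[[[w_conf w_rew] [w_star _]] w_gain] w_mart] /=.
have rewM i t : (0 < t)%N -> `|reward k sigma H i t w| <= M.
  move=> t0; have /andP[ar rb] := w_rew i t t0.
  rewrite ler_norml /M; have := ler_norm b; have := ler_norm (- a).
  by rewrite normrN; have := normr_ge0 a; have := normr_ge0 b; lra.
have decomp := regret_decomposition hkernel hkdiag hsigma hT hbeta0 hbeta hucb
  (fun i t => @nominee_argmax _ _ _ _ _ _ _ _ _ _ _ _ _ _ hmodel i t w)
  w_conf w_star w_gain.
apply: le_trans decomp _; rewrite lerD2l mulrDl.
have hedge := hedge_regret (r := fun i t => reward k sigma H i t w) ucb hT hc0 heta
  (fun i t tT => rewM i t (proj1 (andP tT))).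
(* Rewards are bounded by [M] at this [w], so clipping is the identity. The mixed reward then
   cancels between this identity and [hedge]. *)
have : hedge_martingale k sigma eta H M T w =
    \sum_(1 <= t < T.+1) \sum_i
      hedge_weight (eta t) (fun l => gain k sigma H l t.-1 w) i *
      reward k sigma H i t w -
    \sum_(1 <= t < T.+1) reward k sigma H (arm H t w) t w.
  rewrite -sumrB; apply: eq_big_nat => t /andP[t0 _].
  rewrite hedge_incrementE clipped_rewardE ?rewM//; congr (_ - _).
  by apply: eq_bigr => i _; rewrite clipped_rewardE ?rewM.
move: w_mart hedge; rewrite /= /gain; lra.
Qed.
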